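(* For every integer $r\ge 3$ there exists a constant $c=c_r>0$ such that every ordered $r$-graph $H$ with at least one edge contains a split subgraph $G$ with $d(G)\ge c\, d(H)$.
   Context: An ordered $r$-graph is a finite $r$-uniform hypergraph whose vertex set is linearly ordered; a subgraph inherits the ordering. For subsets $A,B$ of an ordered set, $A<B$ means $a<b$ for all $a\in A$, $b\in B$. An interval is a set of consecutive vertices in the ordering. An ordered $r$-graph $F$ is a split hypergraph if there is a partition of $V(F)$ into intervals $X_1<X_2<\dots<X_{r-1}$ and there exists $i\in\{1,\dots,r-1\}$ such that every edge of $F$ has two vertices in $X_i$ and one vertex in every $X_j$ with $j\ne i$. A split subgraph is a subgraph that is a split hypergraph. For a hypergraph $H$, $e(H)$ is its number of edges, $v(H)=\big|\bigcup_{e\in H}e\big|$ is the number of vertices lying in at least one edge, and $d(H)=e(H)/v(H)^{r-1}$ is the codegree density. *)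

(* Defs.v *)
From HB Require Import structures.
From mathcomp Require Import all_boot all_order all_algebra.
From mathcomp Require Import reals.

Set Implicit Arguments.
Unset Strict Implicit.
Unset Printing Implicit Defensive.

Import Order.TTheory GRing.Theory Num.Theory.

Local Open Scope ring_scope.

(* The vertex set is a subset of an ambient finite linear order, so that
   subgraphs inherit the ordering without any relabelling.  Isolated vertices
   are allowed. *)
Record ordered_rgraph (disp : Order.disp_t) (T : finOrderType disp) (r : nat) :=
  OrderedRGraph {
    vertices : {set T};
    edges : {set {set T}};
    edges_sub : forall e, e \in edges -> e \subset vertices;
    edges_card : forall e, e \in edges -> #|e| = r
  }.

Definition subgraph (disp : Order.disp_t) (T : finOrderType disp) (r : nat)
    (G H : ordered_rgraph T r) : Prop :=
  vertices G \subset vertices H /\ edges G \subset edges H.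

Definition set_before (disp : Order.disp_t) (T : finOrderType disp)
    (A B : {set T}) : Prop :=
  forall a b, a \in A -> b \in B -> (a < b)%O.

Definition consecutive_in (disp : Order.disp_t) (T : finOrderType disp)
    (V A : {set T}) : Prop :=
  A \subset V /\
  forall x y z, x \in A -> y \in A -> z \in V -> (x <= z <= y)%O -> z \in A.

(* The parts X_1 < ... < X_{r-1} are indexed from 0.  The parts of a MathComp
   [partition] are nonempty; this is automatic once F has an edge, since every
   edge meets every part. *)
Definition is_split (disp : Order.disp_t) (T : finOrderType disp) (r : nat)
    (F : ordered_rgraph T r) : Prop :=
  exists X : 'I_r.-1 -> {set T},
    [/\ partition [set X j | j : 'I_r.-1] (vertices F),
        forall j, consecutive_in (vertices F) (X j),
        forall j k : 'I_r.-1, (j < k)%N -> set_before (X j) (X k)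
      & exists i : 'I_r.-1, forall e, e \in edges F ->
          #|e :&: X i| = 2%N /\ forall j, j != i -> #|e :&: X j| = 1%N].

Definition nb_edges (disp : Order.disp_t) (T : finOrderType disp) (r : nat)
    (H : ordered_rgraph T r) : nat := #|edges H|.

(* Only the non-isolated vertices are counted. *)
Definition nb_covered (disp : Order.disp_t) (T : finOrderType disp) (r : nat)
    (H : ordered_rgraph T r) : nat := #|\bigcup_(e in edges H) e|.

(* For an edgeless graph this is 0 / 0 = 0. *)
Definition codegree_density (R : realType) (disp : Order.disp_t)
    (T : finOrderType disp) (r : nat) (H : ordered_rgraph T r) : R :=
  (nb_edges H)%:R / (nb_covered H)%:R ^+ r.-1.

(* Main.v *)
(** Let n be the number of covered vertices, identified with their ranks.  For
    an edge, let t be the second smallest of its r-1 gaps between consecutive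
    ranks, and let s = 2^a be the scale with s <= t < 2s.  Cut the ranks into
    blocks of length s.  All gaps but the smallest are at least s, so the edges
    with the same smallest gap i, second smallest gap k and vector of blocks
    form a split graph on at most rs vertices.  Both gaps i and k are shorter
    than 2s, which leaves only O((n/s)^(r-2)) vectors of blocks.  If every split
    subgraph had density at most delta, there would thus be
    O((n/s)^(r-2) delta s^(r-1)) = O(delta n^(r-2) s) edges at scale s; the sum
    over the dyadic scales s <= n is geometric, so e(H) = O(delta n^(r-1)). *)

Require Import Defs.
From HB Require Import structures.
From mathcomp Require Import all_boot all_order all_algebra.
From mathcomp Require Import reals.
From mathcomp Require Import zify ring lra.

Set Implicit Arguments.
Unset Strict Implicit.
Unset Printing Implicit Defensive.

Import Order.TTheory GRing.Theory Num.Theory.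

(** * Gaps and blocks of an increasing sequence of positions *)

Definition gap (p : seq nat) (l : nat) : nat := nth 0 p l.+1 - nth 0 p l.

(** Here [i] stands for the smallest gap and [k] for the second smallest, but only the resulting
    bounds are recorded, not minimality. Gap [k] lies in [s, 2s). *)
Definition separated (m : nat) (p : seq nat) (s : nat) (i k : 'I_m) : bool :=
  [&& i != k, gap p i < 2 * s, gap p k < 2 * s
    & [forall j : 'I_m, (j != i) ==> (s <= gap p j)]].

(** Take [i] minimizing the gap, [k] minimizing it among the other indices, and 2^a the largest
    power of 2 that is at most gap [k]. As gap [k] is below [n], so is the scale. *)
Lemma separated_exists (m n : nat) (p : seq nat) :
  1 < m -> sorted ltn p -> size p = m.+1 -> all (ltn^~ n) p ->
  exists a : 'I_(trunc_log 2 n).+1, exists i k : 'I_m, separated p (2 ^ a) i k.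
Proof.
move=> m1 sp szp /all_nthP pn.
have m0 : 0 < m by lia.
pose i := [arg min_(i < Ordinal m0) gap p i].
have imin (j : 'I_m) : gap p i <= gap p j.
  by rewrite /i; case: arg_minnP => // i0 _; exact.
have [k0 k0i] : exists k0 : 'I_m, k0 != i.
  have [i0|i0] := eqVneq (val i) 0.
    by exists (Ordinal m1); rewrite -val_eqE /= i0.
  by exists (Ordinal m0); rewrite -val_eqE /= eq_sym.
pose k := [arg min_(k < k0 | k != i) gap p k].
have [ki kmin] : k != i /\ forall j : 'I_m, j != i -> gap p k <= gap p j.
  by rewrite /k; case: arg_minnP.
have pS (l : 'I_m) : nth 0 p l < nth 0 p l.+1.
  have lm := ltn_ord l.
  by apply: (sorted_ltn_nth ltn_trans) => //; rewrite inE szp; lia.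
have gk0 : 0 < gap p k by have := pS k; rewrite /gap; lia.
have gkn : gap p k < n.
  by have := pn 0 k.+1; rewrite szp ltnS ltn_ord /gap => /(_ isT) /=; lia.
have /andP[ta tb] := trunc_log_bounds (isT : 1 < 2) gk0.
have lta : trunc_log 2 (gap p k) < (trunc_log 2 n).+1.
  by rewrite ltnS leq_trunc_log // ltnW.
exists (Ordinal lta), i, k; rewrite /separated eq_sym ki /= -expnS tb /=.
rewrite (leq_ltn_trans (imin k)) //=.
by apply/forallP => j; apply/implyP => /kmin; exact: leq_trans.
Qed.

Lemma ltn_div2r_add (s x y : nat) : 0 < s -> x + s <= y -> x %/ s < y %/ s.
Proof.
move=> s0 /(leq_div2r s); rewrite divnDr ?dvdnn // divnn s0 addn1.
exact: leq_trans.
Qed.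

Lemma sorted_nth_leq (m : nat) (p : seq nat) (l l' : nat) :
  sorted ltn p -> size p = m.+1 -> l <= l' -> l' <= m -> nth 0 p l <= nth 0 p l'.
Proof.
move=> sp szp; rewrite leq_eqVlt => /orP[/eqP-> //|ll' l'm]; apply: ltnW.
by apply: (sorted_ltn_nth ltn_trans) => //; rewrite inE szp; lia.
Qed.

Section SeparatedPositions.
Variables (m s : nat) (p : seq nat) (i k : 'I_m).
Hypotheses (s_gt0 : 0 < s) (sorted_p : sorted ltn p) (size_p : size p = m.+1).
Hypothesis sep : separated p s i k.

Let q l := nth 0 p l %/ s.

Let nth_leq (l l' : nat) := @sorted_nth_leq m p l l' sorted_p size_p.

Let block_leq (l l' : nat) : l <= l' -> l' <= m -> q l <= q l'.
Proof. by move=> ll' l'm; apply: leq_div2r; exact: nth_leq. Qed.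

(** A gap of length at least [s] forces a change of block, and only gap [i] can be shorter. Any pair
    of positions other than (i, i+1) spans another gap: gap [l] if [l] differs from [i], gap i+1
    otherwise. *)
Lemma block_ltn (l l' : nat) : l < l' -> l' <= m ->
  ~~ ((l == i) && (l' == i.+1)) -> q l < q l'.
Proof.
move=> ll' l'm.
have step (j : nat) : j < m -> j != i -> nth 0 p j + s <= nth 0 p j.+1.
  move=> jm ji; case/and4P: sep => _ _ _ /forallP /(_ (Ordinal jm)) /implyP.
  have := @nth_leq j j.+1 (leqnSn j) jm.
  by rewrite -val_eqE /= => h /(_ ji); rewrite /gap; lia.
rewrite negb_and; have [li /= l'i|li _] := eqVneq l i; last first.
  have lm : l < m by lia.
  apply: ltn_div2r_add => //; apply: leq_trans (step _ lm li) _.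
  exact: nth_leq.
rewrite li; have i1m : i.+1 < m by lia.
apply: (@leq_ltn_trans (q i.+1)); first by apply: block_leq; rewrite ?ltn_ord.
apply: ltn_div2r_add => //; apply: leq_trans (step _ i1m _) _; first by lia.
by apply: nth_leq => //; lia.
Qed.

(** Blocks increase strictly except possibly across gap [i], so the block condition amounts to the
    position lying between [bump i.+1 j] and [bump i j]: positions i and i+1 if j = i, a single
    position otherwise. *)
Lemma count_block_part (j : 'I_m) :
  count (fun x => q (bump i.+1 j) <= x %/ s <= q (bump i j)) p = (j == i).+1.
Proof.
rewrite -[X in count _ X](mkseq_nth 0) size_p count_map.
rewrite (@eq_in_count _ _ (fun l => bump i.+1 j <= l <= bump i j)); last first.
  move=> l; rewrite mem_iota /= -/(q l) => /[!ltnS] lm.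
  have jm := ltn_ord j.
  have [h1|h1] := leqP (bump i.+1 j) l; have [h2|h2] := leqP l (bump i j) => /=.
  - by rewrite !block_leq //; rewrite /bump; lia.
  - by rewrite andbC leqNgt block_ltn // /bump; lia.
  - by rewrite leqNgt block_ltn //; move: h1; rewrite /bump; lia.
  - by rewrite leqNgt block_ltn //; move: h1; rewrite /bump; lia.
have jm := ltn_ord j.
have [->|ji] := eqVneq j i.
  rewrite (@eq_count _ _ (predU (pred1 (i : nat)) (pred1 i.+1))); last first.
    by move=> l /=; rewrite /bump; lia.
  have := count_predUI (pred1 (i : nat)) (pred1 i.+1) (iota 0 m.+1).
  rewrite !count_uniq_mem ?iota_uniq // !mem_iota (@eq_count _ (predI _ _) pred0).
    by rewrite count_pred0; have := ltn_ord i; lia.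
  by move=> l /=; lia.
rewrite (@eq_count _ _ (pred1 (bump i j))); last first.
  by move=> l /=; move: ji; rewrite -val_eqE /bump /=; lia.
by rewrite count_uniq_mem ?iota_uniq // mem_iota /bump; lia.
Qed.

End SeparatedPositions.

Lemma leq_card_bigcup (I T : finType) (P : pred I) (B : I -> {set T}) :
  #|\bigcup_(j | P j) B j| <= \sum_(j | P j) #|B j|.
Proof.
apply: (big_ind2 (fun (A : {set T}) n => #|A| <= n)); rewrite ?cards0 //.
move=> A n A' n' An An'; apply: leq_trans (leq_add An An').
by rewrite leq_card_setU.
Qed.

(** * Ranks of vertices within a vertex set *)

Section Ranks.
Variables (disp : Order.disp_t) (T : finOrderType disp) (V : {set T}).
Implicit Types (x y : T) (e : {set T}).

Definition rank_in x : nat := #|[set y in V | (y < x)%O]|.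

Lemma rank_in_leq x y : (x <= y)%O -> rank_in x <= rank_in y.
Proof.
move=> xy; apply/subset_leq_card/subsetP => z; rewrite !inE => /andP[->] /=.
by move=> /lt_le_trans; apply.
Qed.

Lemma rank_in_ltn x y : x \in V -> (x < y)%O -> rank_in x < rank_in y.
Proof.
move=> xV xy; apply/proper_card/properP; split.
  by apply/subsetP => z; rewrite !inE => /andP[->] /= /lt_trans; apply.
by exists x; rewrite !inE xV ?xy ?ltxx.
Qed.

Lemma rank_in_inj : {in V &, injective rank_in}.
Proof.
move=> x y xV yV rxy; have [xy|yx|//] := ltgtP x y.
- by have := rank_in_ltn xV xy; rewrite rxy ltnn.
- by have := rank_in_ltn yV yx; rewrite rxy ltnn.
Qed.

Lemma rank_in_ltn_card x : x \in V -> rank_in x < #|V|.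
Proof.
move=> xV; apply/proper_card/properP; split.
  by apply/subsetP => z; rewrite !inE => /andP[].
by exists x; rewrite ?inE ?xV ?ltxx.
Qed.

(** Ranks are injective on [V], and block [b] contains only the [s] integers from [b * s] on. *)
Lemma card_rank_block (s b : nat) : 0 < s ->
  #|[set x in V | rank_in x %/ s == b]| <= s.
Proof.
move=> s0; set A := [set x in V | _].
rewrite cardE -(size_map rank_in) -[leqRHS](size_iota (b * s)).
apply: uniq_leq_size.
  rewrite map_inj_in_uniq ?enum_uniq // => x y.
  by rewrite !mem_enum !inE => /andP[xV _] /andP[yV _]; exact: rank_in_inj.
move=> z /mapP[x]; rewrite mem_enum inE mem_iota => /andP[_ /eqP<-] ->.
by rewrite leq_divM /= addnC -mulSn ltn_ceil.
Qed.

(** The sort is there because [enum] need not follow the order of [T]. *)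
Definition ranks e : seq nat := sort leq [seq rank_in x | x <- enum e].

Lemma size_ranks e : size (ranks e) = #|e|.
Proof. by rewrite size_sort size_map -cardE. Qed.

Lemma sorted_ranks e : e \subset V -> sorted ltn (ranks e).
Proof.
move=> /subsetP eV; rewrite ltn_sorted_uniq_leq sort_uniq.
rewrite sort_sorted ?andbT; last exact: leq_total.
rewrite map_inj_in_uniq ?enum_uniq // => x y.
by rewrite !mem_enum => /eV xV /eV yV; exact: rank_in_inj.
Qed.

Lemma mem_ranks e x : x \in e -> rank_in x \in ranks e.
Proof. by move=> xe; rewrite mem_sort map_f // mem_enum. Qed.

Lemma ranksP e (n : nat) : n \in ranks e -> exists2 x, x \in e & n = rank_in x.
Proof. by rewrite mem_sort => /mapP[x]; rewrite mem_enum; exists x. Qed.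

Lemma count_ranks (a : pred nat) e :
  count a (ranks e) = #|[set x in e | a (rank_in x)]|.
Proof.
have /permP -> : perm_eq (ranks e) [seq rank_in x | x <- enum e].
  by rewrite perm_sort.
rewrite count_map -size_filter cardE /enum_mem -filter_predI; congr size.
by apply: eq_filter => x /=; rewrite !inE andbC.
Qed.

End Ranks.

(** * Edges with a common block vector form a small split graph *)

Section SplitClass.
Variables (disp : Order.disp_t) (T : finOrderType disp) (m : nat).
Variables (H : ordered_rgraph T m.+1) (V : {set T}) (F : {set {set T}}).
Variables (s : nat) (i k : 'I_m) (q : nat -> nat).
Hypotheses (s_gt0 : 0 < s) (F_sub : F \subset edges H).
Hypothesis F_V : forall e, e \in F -> e \subset V.
Hypothesis F_sep : forall e, e \in F -> separated (ranks V e) s i k.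
Hypothesis F_q : forall e, e \in F ->
  forall l, l <= m -> nth 0 (ranks V e) l %/ s = q l.

Let VG := \bigcup_(e in F) e.

(* [bump i.+1 j] and [bump i j] are the first and last positions of the vertices
   of an edge lying in part j: they are i and i.+1 for j = i, and otherwise
   both are j or j.+1 according to j < i or j > i. *)
Let X (j : 'I_m) : {set T} :=
  [set x in VG | q (bump i.+1 j) <= rank_in V x %/ s <= q (bump i j)].

Let G_sub (e : {set T}) : e \in F -> e \subset VG.
Proof. exact: bigcup_sup. Qed.

Let G_card (e : {set T}) : e \in F -> #|e| = m.+1.
Proof. by move/(subsetP F_sub)/edges_card. Qed.

(** With the union of the edges as vertex set, every vertex occupies a position in some edge of [F],
    hence lies in one of the common blocks [q l]. *)
Definition class_graph := OrderedRGraph G_sub G_card.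

Let F_size e : e \in F -> size (ranks V e) = m.+1.
Proof. by move=> eF; rewrite size_ranks G_card. Qed.

Let F_sorted e : e \in F -> sorted ltn (ranks V e).
Proof. by move/F_V/sorted_ranks. Qed.

Let VG_V : VG \subset V.
Proof. by apply/bigcupsP => e; exact: F_V. Qed.

Let block_mem x : x \in VG -> exists2 l, l <= m & rank_in V x %/ s = q l.
Proof.
case/bigcupP => e eF xe; have /(nthP 0)[l] := mem_ranks V xe.
by rewrite size_ranks G_card // ltnS => lm <-; exists l; rewrite ?F_q.
Qed.

Lemma class_subgraph : subgraph class_graph H.
Proof.
split=> //=; apply/bigcupsP => e /(subsetP F_sub); exact: edges_sub.
Qed.

(** The vertices lie in the m+1 blocks [q l], each with at most [s] elements of [V]. *)
Lemma class_nb_covered : nb_covered class_graph <= m.+1 * s.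
Proof.
pose B l := [set x in V | rank_in V x %/ s == q l].
have sub : VG \subset \bigcup_(l < m.+1) B l.
  apply/subsetP => x xVG; have [l lm ql] := block_mem xVG.
  apply/bigcupP; exists (Ordinal (lm : l < m.+1)) => //.
  by rewrite inE (subsetP VG_V) //= ql.
apply: leq_trans (subset_leq_card sub) _.
apply: leq_trans (leq_card_bigcup _ _) _.
rewrite -[m.+1 in leqRHS]card_ord -sum_nat_const.
by apply: leq_sum => l _; exact: card_rank_block.
Qed.

(** Since [q] is common to the class, a single edge [e0] yields its monotonicity and shows that no
    part is empty; [count_block_part], applied to each edge, gives the intersection sizes. *)
Lemma class_is_split : F != set0 -> is_split class_graph.
Proof.
case/set0Pn => e0 e0F.
have q_ltn (l l' : nat) : l < l' -> l' <= m ->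
    ~~ ((l == i) && (l' == i.+1)) -> q l < q l'.
  move=> ll' l'm; rewrite -!(F_q e0F) ?(leq_trans (ltnW ll')) //.
  exact: (block_ltn s_gt0 (F_sorted e0F) (F_size e0F) (F_sep e0F)).
have q_leq (l l' : nat) : l <= l' -> l' <= m -> q l <= q l'.
  move=> ll' l'm; rewrite -!(F_q e0F) ?(leq_trans ll') //.
  exact/leq_div2r/(sorted_nth_leq (F_sorted e0F) (F_size e0F)).
(* The value i is never taken by [bump i], so the exceptional pair (i, i+1) does not arise. *)
have q_part (j j' : 'I_m) : j < j' -> q (bump i j) < q (bump i.+1 j').
  by have := ltn_ord j'; move=> ? ?; apply: q_ltn; rewrite /bump; lia.
have before (j j' : 'I_m) : j < j' -> set_before (X j) (X j').
  move=> jj' x y; rewrite !inE => /andP[_ /andP[_ hx]] /andP[_ /andP[hy _]].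
  rewrite ltNge; apply/negP => /(rank_in_leq V) /(leq_div2r s).
  by have := q_part _ _ jj'; lia.
have card_part e j : e \in F -> #|e :&: X j| = (j == i).+1.
  move=> eF.
  rewrite -(count_block_part s_gt0 (F_sorted eF) (F_size eF) (F_sep eF) j).
  rewrite count_ranks; apply: eq_card => x; rewrite !inE.
  have jm := ltn_ord j; rewrite !F_q //; try by rewrite /bump; lia.
  by have [xe|//] := boolP (x \in e); rewrite (subsetP (G_sub eF)).
have X_ne j : X j != set0.
  have := card_part e0 j e0F; apply: contra_eq_neq => ->.
  by rewrite setI0 cards0.
have disj (j j' : 'I_m) x : x \in X j -> x \in X j' -> j = j'.
  move=> xj xj'; apply: val_inj; have [jj'|jj'|//] := ltngtP j j'.
  - by have := before _ _ jj' x x xj xj'; rewrite ltxx.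
  - by have := before _ _ jj' x x xj' xj; rewrite ltxx.
exists X; split => //.
- apply/and3P; split.
  + rewrite eqEsubset; apply/andP; split.
      apply/bigcupsP => _ /imsetP[j _ ->].
      by apply/subsetP => x; rewrite inE => /andP[].
    apply/subsetP => x xVG.
    have [l lm ql] := block_mem xVG.
    have im := ltn_ord i.
    (* Positions i and i+1 share part i, so indices drop by one after position i. *)
    have jm : (if l <= i then l else l.-1) < m by case: ifP; lia.
    apply/bigcupP; exists (X (Ordinal jm)); first exact: imset_f.
    by rewrite inE xVG ql /= !q_leq // /bump; case: ifP; lia.
  + apply/trivIsetP => _ _ /imsetP[j _ ->] /imsetP[j' _ ->] jj'.
    apply/pred0P => x /=; apply/negbTE/negP => /andP[xj xj'].
    by rewrite (disj _ _ _ xj xj') eqxx in jj'.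
  + by apply/imsetP => -[j _ X0]; have := X_ne j; rewrite -X0 eqxx.
- move=> j; split; first by apply/subsetP => x; rewrite inE => /andP[].
  move=> x y z; rewrite !inE => /andP[_ /andP[hx _]] /andP[_ /andP[_ hy]] zV.
  case/andP => /(rank_in_leq V)/(leq_div2r s) xz /(rank_in_leq V)/(leq_div2r s).
  by move=> zy; rewrite zV (leq_trans hx) ?(leq_trans zy).
- exists i => e eF; split=> [|j ji]; rewrite card_part ?eqxx //.
  by rewrite (negbTE ji).
Qed.

End SplitClass.

(** * Counting by bounded codes *)

Lemma card_ord_ltn (n b : nat) : #|[pred x : 'I_n | x < b]| <= b.
Proof.
rewrite cardE -(size_map val) -[leqRHS](size_iota 0).
apply: uniq_leq_size; first by rewrite (map_inj_uniq val_inj) enum_uniq.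
by move=> z /mapP[x]; rewrite mem_enum mem_iota => xb ->.
Qed.

(** There are at most [\prod_j B j] codes, and each nonempty fibre of the coding has at most [M]
    elements. *)
Lemma leq_card_code (R : numDomainType) (I U : finType) (A : {set U})
    (f : U -> I -> nat) (B : I -> nat) (M : R) :
  (0 <= M)%R ->
  (forall u, u \in A -> forall j, f u j < B j) ->
  (forall u, u \in A ->
     (#|[set v in A | [forall j, f v j == f u j]]|%:R <= M)%R) ->
  (#|A|%:R <= (\prod_j B j)%:R * M)%R.
Proof.
(* The common bound [n] makes the codes a finite type; the family [Q] restores the separate bounds
   [B j]. *)
move=> M0 fB fM; pose n := \max_j B j.
pose code u : {ffun I -> 'I_n.+1} := [ffun j => inord (f u j)].
pose Q : pred {ffun I -> 'I_n.+1} :=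
  family (fun j => [pred x : 'I_n.+1 | x < B j]).
have codeE u j : u \in A -> code u j = f u j :> nat.
  move=> uA; rewrite ffunE inordK // ltnS (leq_trans (ltnW (fB u uA j))) //.
  exact: leq_bigmax.
have codeQ u : u \in A -> Q (code u).
  by move=> uA; apply/familyP => j; rewrite inE codeE // fB.
rewrite -sum1_card (partition_big code Q) //= natr_sum.
apply: (@le_trans _ _ (\sum_(g | Q g) M)%R).
  apply: ler_sum => g _; rewrite sum1_card.
  have [->//|/card_gt0P[u]] := posnP #|[pred v in A | code v == g]|.
  rewrite inE => /andP[uA /eqP cu]; apply: le_trans (fM u uA).
  rewrite ler_nat; apply/subset_leq_card/subsetP => v; rewrite !inE -cu.
  case/andP=> vA /eqP cv; rewrite vA; apply/forallP => j.
  by rewrite -!codeE // cv.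
rewrite sumr_const -[leLHS]mulr_natl ler_wpM2r // ler_nat.
rewrite card_family foldrE big_map big_enum /=.
by apply: leq_prod => j _; exact: card_ord_ltn.
Qed.

(** The special positions are i+1 and k+1, those just after gaps [i] and [k]; they are distinct,
    which leaves m ordinary factors. *)
Lemma prod_two_special (m : nat) (i k : 'I_m.+1) (b N : nat) : i != k ->
  \prod_(l < m.+2) (if (l == lift ord0 i) || (l == lift ord0 k) then b else N) =
  b ^ 2 * N ^ m.
Proof.
move=> ik.
have ki : lift ord0 k != lift ord0 i by rewrite (inj_eq lift_inj) eq_sym.
rewrite (bigD1 (lift ord0 i)) //= (bigD1 (lift ord0 k)) //= !eqxx orbT /= mulnA.
congr (_ * _).
rewrite (eq_bigr (fun=> N)); last by move=> l /andP[/negbTE-> /negbTE->].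
rewrite prod_nat_const; congr (_ ^ _).
rewrite (eq_card (B := ~: [set lift ord0 i; lift ord0 k])); last first.
  by move=> l; rewrite !inE negb_or.
by rewrite cardsCs setCK cards2 eq_sym ki card_ord; lia.
Qed.

(** * Bounding the edges when all split subgraphs are sparse *)

Section Counting.
Variables (R : realType) (disp : Order.disp_t) (T : finOrderType disp) (m : nat).
Variables (H : ordered_rgraph T m.+2) (delta : R).
Hypothesis delta_ge0 : (0 <= delta)%R.
Hypothesis split_sparse : forall G : ordered_rgraph T m.+2,
  subgraph G H -> is_split G ->
  ((nb_edges G)%:R <= delta * (nb_covered G)%:R ^+ m.+1)%R.

Let V := \bigcup_(e in edges H) e.

Let e_V e : e \in edges H -> e \subset V.
Proof. exact: bigcup_sup. Qed.

Let e_size e : e \in edges H -> size (ranks V e) = m.+2.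
Proof. by move=> eH; rewrite size_ranks (edges_card eH). Qed.

Let e_sorted e : e \in edges H -> sorted ltn (ranks V e).
Proof. by move/e_V/sorted_ranks. Qed.

Let e_ltn e : e \in edges H -> all (ltn^~ #|V|) (ranks V e).
Proof.
move=> eH; apply/allP => _ /ranksP[x xe ->].
exact/rank_in_ltn_card/(subsetP (e_V eH)).
Qed.

(** Edges with the same code [f] have the same block vector, so each fibre is a split class on at
    most (m+2)s vertices, to which [split_sparse] applies. *)
Lemma card_separated (s : nat) (i k : 'I_m.+1) : 0 < s ->
  (#|[set e in edges H | separated (ranks V e) s i k]|%:R <=
   (3 ^ 2 * (#|V| %/ s).+1 ^ m)%:R * (delta * (m.+2 * s)%:R ^+ m.+1))%R.
Proof.
move=> s0; set A := [set e in _ | _].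
(* A member of [A] is what provides [i != k]. *)
have [->|[e1]] := set_0Vmem A.
  by rewrite cards0 mulr_ge0 ?mulr_ge0 ?exprn_ge0.
rewrite inE => /andP[_ /and4P[ik _ _ _]].
pose q e l := nth 0 (ranks V e) l %/ s.
pose special (l : 'I_m.+2) := (l == lift ord0 i) || (l == lift ord0 k).
(* The entries after the gaps i and k are coded by their increments, which take
   only three values. *)
pose f e (l : 'I_m.+2) := if special l then q e l - q e l.-1 else q e l.
have q_leq e (l : nat) : e \in edges H -> l <= m.+1 -> q e l.-1 <= q e l.
  move=> eH lm; apply/leq_div2r/(sorted_nth_leq (e_sorted eH) (e_size eH)) => //.
  exact: leq_pred.
(* Induction on the position: position 0 is never special, and by [q_leq] the truncated subtraction
   loses nothing. *)
have f_inj e e' : e \in edges H -> e' \in edges H -> (forall l, f e l = f e' l) ->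
    forall l, l <= m.+1 -> q e l = q e' l.
  move=> eH e'H ff; elim=> [|l IHl] lm.
    by have := ff ord0; rewrite /f /special -!val_eqE.
  have := ff (Ordinal (lm : l.+1 < m.+2)); rewrite /f; case: ifP => //= _.
  by have := q_leq e l.+1 eH lm; have := q_leq e' l.+1 e'H lm; rewrite /= IHl; lia.
rewrite -(prod_two_special _ _ ik); apply: (leq_card_code (f := f)).
- by rewrite mulr_ge0 ?exprn_ge0.
- move=> e; rewrite inE => /andP[eH /and4P[_ gi gk _]] l; rewrite /f -/(special l).
  (* Adding less than 2s to a rank raises its block by at most 2. *)
  have gapP (j : 'I_m.+1) : gap (ranks V e) j < 2 * s -> q e j.+1 - q e j < 3.
    rewrite /gap /q => gj; rewrite ltnS leq_subLR -divnDMl //.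
    by apply: leq_div2r; lia.
  case: ifP => [/orP[]/eqP-> /=|_]; rewrite ?lift0; try exact: gapP.
  rewrite /q ltnS leq_div2r // ltnW //.
  by have /all_nthP := e_ltn eH; apply; rewrite e_size.
- move=> e; rewrite inE => /andP[eH es]; set F := [set _ in A | _].
  have eF : e \in F by rewrite !inE eH es; apply/forallP => l.
  have FA e' : e' \in F -> e' \in edges H /\ separated (ranks V e') s i k.
    by rewrite !inE => /andP[/andP[]].
  have FH : F \subset edges H by apply/subsetP => e' /FA[].
  have FV e' : e' \in F -> e' \subset V by case/FA => /e_V.
  have Fs e' : e' \in F -> separated (ranks V e') s i k by case/FA.
  have Fq e' : e' \in F -> forall l, l <= m.+1 -> nth 0 (ranks V e') l %/ s = q e l.
    move=> e'F; apply: f_inj => //; first by case: (FA _ e'F).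
    by move: e'F; rewrite inE => /andP[_ /forallP h] l; apply/eqP.
  have F0 : F != set0 by apply/set0Pn; exists e.
  apply: le_trans (split_sparse (class_subgraph FH)
                     (class_is_split s0 FH FV Fs Fq F0)) _.
  rewrite ler_wpM2l // lerXn2r ?nnegrE ?ler_nat //.
  exact: (class_nb_covered s0 FH FV Fq).
Qed.

(** The factors come from the two increments, the choice of (i, k), the rounding of n/s to m powers
    together with the geometric sum, and the vertex bound (m+2)s. *)
Let split_const := 3 ^ 2 * m.+1 ^ 2 * 2 ^ m.+1 * m.+2 ^ m.+1.

Lemma nb_edges_le : 0 < m -> 0 < #|V| ->
  ((nb_edges H)%:R <= split_const%:R * delta * #|V|%:R ^+ m.+1)%R.
Proof.
move=> m0 V0; set n := #|V|; pose L := (trunc_log 2 n).+1.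
pose A (a : nat) (i k : 'I_m.+1) :=
  [set e in edges H | separated (ranks V e) (2 ^ a) i k].
pose D := 3 ^ 2 * m.+2 ^ m.+1 * (2 * n) ^ m.
have A_le (a : 'I_L) i k : (#|A a i k|%:R <= (D * 2 ^ a)%:R * delta)%R.
  have s0 : 0 < 2 ^ a by rewrite expn_gt0.
  apply: le_trans (card_separated i k s0) _.
  rewrite mulrCA mulrC ler_wpM2r // -natrX -natrM ler_nat.
  have sn : 2 ^ a <= n.
    by apply: leq_trans (trunc_logP (isT : 1 < 2) V0); rewrite leq_exp2l // -ltnS.
  (* As s <= n, rounding up n/s costs at most a factor 2. Of the m+1 factors s, m are absorbed here
     and one remains for the geometric sum. *)
  have Ns : (n %/ 2 ^ a).+1 * 2 ^ a <= 2 * n.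
    by rewrite mulSn mul2n -addnn leq_add // leq_divM.
  have -> : 3 ^ 2 * (n %/ 2 ^ a).+1 ^ m * (m.+2 * 2 ^ a) ^ m.+1 =
      3 ^ 2 * m.+2 ^ m.+1 * ((n %/ 2 ^ a).+1 * 2 ^ a) ^ m * 2 ^ a.
    by rewrite !expnMn [(2 ^ a) ^ m.+1]expnSr; ring.
  by rewrite leq_mul2r leq_mul2l leq_exp2r // Ns !orbT.
have cover : edges H \subset \bigcup_(a < L) \bigcup_i \bigcup_k A a i k.
  apply/subsetP => e eH.
  have [a [i [k sep]]] :=
    separated_exists (m0 : 1 < m.+1) (e_sorted eH) (e_size eH) (e_ltn eH).
  do 3![apply/bigcupP; eexists=> //]; rewrite inE eH; exact: sep.
have card_le : nb_edges H <= \sum_(a < L) \sum_i \sum_k #|A a i k|.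
  apply: leq_trans (subset_leq_card cover) _.
  apply: leq_trans (leq_card_bigcup _ _) _; apply: leq_sum => a _.
  apply: leq_trans (leq_card_bigcup _ _) _; apply: leq_sum => i _.
  exact: leq_card_bigcup.
(* The sum is 2^L - 1, and 2^L is twice a power of 2 that is at most n. *)
have geom : \sum_(a < L) 2 ^ a <= 2 * n.
  have := predn_exp 2 L; rewrite mul1n => <-.
  by rewrite (leq_trans (leq_pred _)) // expnS leq_mul2l trunc_logP.
apply: (@le_trans _ _ (\sum_(a < L) \sum_i \sum_k (D * 2 ^ a)%:R * delta)%R).
  apply: le_trans (_ : (_ <= (\sum_(a < L) \sum_i \sum_k #|A a i k|)%:R)%R) _.
    by rewrite ler_nat.
  rewrite natr_sum; apply: ler_sum => a _; rewrite natr_sum; apply: ler_sum => i _.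
  by rewrite natr_sum; apply: ler_sum => k _; exact: A_le.
have -> : (\sum_(a < L) \sum_(i < m.+1) \sum_(k < m.+1) (D * 2 ^ a)%:R * delta
    = (m.+1 ^ 2 * D * \sum_(a < L) 2 ^ a)%:R * delta :> R)%R.
  rewrite big_distrr /= natr_sum mulr_suml; apply: eq_bigr => a _.
  rewrite !sumr_const card_ord -mulrnA -[LHS]mulr_natl mulrA -natrM.
  by congr (_%:R * _)%R; lia.
rewrite mulrAC ler_wpM2r // -natrX -natrM ler_nat.
apply: leq_trans (leq_mul (leqnn _) geom) _.
rewrite /D /split_const expnMn [2 ^ m.+1]expnS [n ^ m.+1]expnS; apply: eq_leq.
move: (m.+1 ^ 2) (m.+2 ^ m.+1) (2 ^ m) (n ^ m) => x y z w; ring.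
Qed.

End Counting.

(** * From edge counts to densities *)

Lemma nb_covered_gt0 (disp : Order.disp_t) (T : finOrderType disp) (r : nat)
    (H : ordered_rgraph T r.+1) : 0 < nb_edges H -> 0 < nb_covered H.
Proof.
case/card_gt0P => e eH; apply: (@leq_trans #|e|); first by rewrite (edges_card eH).
by apply: subset_leq_card; apply: bigcup_sup eH.
Qed.

Local Open Scope ring_scope.

Theorem theorem2p2 (R : realType) (r : nat) (hr : (3 <= r)%N) :
  exists c : R, 0 < c /\
    forall (disp : Order.disp_t) (T : finOrderType disp)
           (H : ordered_rgraph T r),
      (0 < nb_edges H)%N ->
      exists G : ordered_rgraph T r,
        [/\ subgraph G H, is_split G
          & c * codegree_density R H <= codegree_density R G].
Proof.
case: r hr => [|[|m]] // hr.
pose C := (3 ^ 2 * m.+1 ^ 2 * 2 ^ m.+1 * m.+2 ^ m.+1)%N.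
have C_gt0 : 0 < C%:R :> R by rewrite ltr0n !muln_gt0 !expn_gt0.
(* The factor 2 yields the contradiction: if no split subgraph is dense enough, [nb_edges_le] bounds
   e(H) by e(H)/2. *)
exists (2 * C%:R)^-1; split=> [|disp T H H_gt0]; first by rewrite invr_gt0 mulr_gt0.
apply: boolp.contrapT => no_split.
set delta := (2 * C%:R)^-1 * codegree_density R H.
have delta_ge0 : 0 <= delta.
  by rewrite /delta /codegree_density !mulr_ge0 ?invr_ge0 ?mulr_ge0 ?exprn_ge0.
have sparse (G : ordered_rgraph T m.+2) : subgraph G H -> is_split G ->
    (nb_edges G)%:R <= delta * (nb_covered G)%:R ^+ m.+1.
  (* A graph violating the bound has an edge, so its covered set is nonempty and the division by a
     power of its size is legitimate. *)
  move=> GH splitG; rewrite leNgt; apply/negP => dense; apply: no_split.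
  exists G; split=> //; rewrite -/delta /codegree_density ler_pdivlMr ?ltW //.
  rewrite exprn_gt0 // ltr0n nb_covered_gt0 // -(ltr0n R).
  by apply: le_lt_trans dense; rewrite mulr_ge0 ?exprn_ge0.
have n_gt0 := nb_covered_gt0 H_gt0.
have := nb_edges_le delta_ge0 sparse hr n_gt0.
rewrite -/C -/(nb_covered H) /delta /codegree_density /=.
have : 0 < (nb_edges H)%:R :> R by rewrite ltr0n.
have : (nb_covered H)%:R ^+ m.+1 != 0 :> R by rewrite expf_neq0 // pnatr_eq0 -lt0n.
move: (_ ^+ _) C_gt0 => N; move: C%:R (nb_edges H)%:R => K x K_gt0 N_neq0 x_gt0.
have -> : K * ((2 * K)^-1 * (x / N)) * N = x / 2.
  by field; rewrite N_neq0 gt_eqF.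
lra.
Qed.
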